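(* The function $h:(-1,\infty)\to\mathbb{R}$ defined by $$h(x)=\begin{cases}\bigl(x^2-1\bigr)\psi'(x)-\psi\bigl(x^2\bigr),&x\ne0,\\ 1+\gamma-\dfrac{\pi^2}6,&x=0, \end{cases}$$ is strictly increasing on $(-1,\infty)$, with $$\lim_{x\to-1^+}h(x)=-\infty\quad \text{and}\quad \lim_{x\to\infty}h(x)=\infty.$$
   Context: $\Gamma$ is Euler's gamma function (extended meromorphically, with poles at $0,-1,-2,\ldots$), $\psi(x)=\Gamma'(x)/\Gamma(x)$ is the psi (digamma) function, defined for real $x\ne0,-1,-2,\ldots$, $\psi'$ is its derivative (so that $\psi'(x)=\sum_{k=0}^\infty\frac1{(x+k)^2}$ for $x\neq 0,-1,-2,\ldots$), and $\gamma=0.577\ldots$ is the Euler–Mascheroni constant. *)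

(* Defs.v *)
From Stdlib Require Import Reals ZArith.
From Coquelicot Require Import Coquelicot.
Open Scope R_scope.

(** Euler's integral; meaningful for [0 < x]. *)
Definition Gamma_integral (x : R) : R :=
  RInt_gen (fun t => Rpower t (x - 1) * exp (- t))
    (at_right 0) (Rbar_locally p_infty).

(** [n] uses of [Gamma x = Gamma (x + 1) / x]. *)
Fixpoint Gamma_shift (n : nat) (x : R) : R :=
  match n with
  | O => Gamma_integral x
  | S m => Gamma_shift m (x + 1) / x
  end.

(** The number of shifts, [Z.to_nat (up (- x))], is the least natural number [n]
    with [0 < x + INR n]; it is [0] when [0 < x].  At the poles
    [0, -1, -2, ...] the value is meaningless. *)
Definition Gamma (x : R) : R := Gamma_shift (Z.to_nat (up (- x))) x.

Definition psi (x : R) : R := Derive Gamma x / Gamma x.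

(** [lim (1 + 1/2 + ... + 1/(n+1) - ln (n+1))]; [sum_f_R0 _ n] has [n + 1] terms. *)
Definition Euler_gamma : R :=
  real (Lim_seq (fun n => sum_f_R0 (fun k => / INR (S k)) n - ln (INR (S n)))).

(** Only the values for [-1 < x] are meaningful. *)
Definition h (x : R) : R :=
  if Req_dec_T x 0 then 1 + Euler_gamma - PI ^ 2 / 6
  else (x ^ 2 - 1) * Derive psi x - psi (x ^ 2).

(* Main.v *)
Require Import Defs.
From Stdlib Require Import Reals Lra Lia Psatz.
From Coquelicot Require Import Coquelicot.
Open Scope R_scope.

(** Removing the singular part of [psi'] at 0 with [psi x = psi (x + 1) - / x] gives, on the whole
    of [(-1, +oo)], the regular formula [h_eq]:
    [h x = 1 + (x ^ 2 - 1) * psi' (x + 1) - psi (x ^ 2 + 1)].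
    At 0 it takes the prescribed value because [psi 1 = - Euler_gamma] and [psi' 1 = PI ^ 2 / 6].
    Expanding both functions in series, [h x] is a constant plus the sum over [K >= 1] of
    [(x ^ 2 - 1) / (x + K) ^ 2 - 1 / K + 1 / (x ^ 2 + K)], and the derivative of this summand is
    [2 K (x - 1) ^ 2 (x ^ 3 + 2 x ^ 2 + 2 K x + K) / ((x + K) ^ 3 (x ^ 2 + K) ^ 2)]
    ([h_term_deriv_factor]).  For [x >= -1/2] it is nonnegative for every [K], and positive for
    [K = 1] except at [x = 1].  For [-1 < x <= -1/2] it is at least 8 for [K = 1] and at least
    [- 2 / (K - 1) ^ 2] for [K >= 2]; these losses sum up to [- PI ^ 2 / 3], which is above [-8].
    The mean value theorem is applied to the summands, so the series need not be differentiated.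
    The limits follow from [psi' z >= 1 / z ^ 2] and the monotonicity of [psi] near [-1], and from
    [psi' z >= 1 / z] and [psi z <= ln z] at infinity.

    The analytic input is the series for [psi], obtained without differentiating under the integral
    sign.  Euler's integral satisfies the functional equation and Wendel's inequality
    [Gamma (y + s) <= y ^ s * Gamma y] for [0 <= s <= 1] ([Gamma_integral_add_le]).  As in the
    Bohr-Mollerup theorem they determine [ln Gamma y - ln Gamma x] as the limit of
    [(y - x) * ln n] minus the sum of [ln (y + k) - ln (x + k)] ([is_lim_seq_ln_Gamma_sub]).
    Subtracting [(y - x) * psi x], with [psi] given by its series, leaves a series that is quadratic
    in [y - x]; so [ln Gamma] is differentiable with derivative [psi] ([is_derive_ln_Gamma]).
    The series of [psi] is differentiated in the same way ([is_derive_digamma_series]).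

    The sum of the inverse squares ([basel]) comes from the integrals of [cos t ^ (2 n)] and
    [t ^ 2 * cos t ^ (2 n)] over [[0, PI / 2]]: integration by parts shows that [1 / n ^ 2] is twice
    the difference of their consecutive ratios, and the ratios tend to 0. *)

(** * The sum of the inverse squares *)

Definition cos_moment (n : nat) : R := RInt (fun t => cos t ^ (2 * n)) 0 (PI / 2).

(** The partial sums of the inverse squares telescope in terms of the ratios of
    [sq_cos_moment] to [cos_moment]. *)
Definition sq_cos_moment (n : nat) : R := RInt (fun t => t ^ 2 * cos t ^ (2 * n)) 0 (PI / 2).

Lemma ex_derive_RInt f a b : (forall t, ex_derive f t) -> ex_RInt (V := R_NormedModule) f a b.
Proof.
  intros H; apply (ex_RInt_continuous (V := R_CompleteNormedModule)).
  intros t _; now apply (ex_derive_continuous (K := R_AbsRing) (V := R_NormedModule)).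
Qed.

Lemma cos_moment_correct n : is_RInt (fun t => cos t ^ (2 * n)) 0 (PI / 2) (cos_moment n).
Proof.
  apply (RInt_correct (V := R_CompleteNormedModule)), ex_derive_RInt.
  intros t; auto_derive; easy.
Qed.

Lemma sq_cos_moment_correct n :
  is_RInt (fun t => t ^ 2 * cos t ^ (2 * n)) 0 (PI / 2) (sq_cos_moment n).
Proof.
  apply (RInt_correct (V := R_CompleteNormedModule)), ex_derive_RInt.
  intros t; auto_derive; easy.
Qed.

(** Both moment recurrences come from computing one integral twice: by linearity
    from the moments, and as the boundary values of an explicit antiderivative. *)
Lemma is_RInt_inj (f : R -> R) a b l l' : is_RInt f a b l -> is_RInt f a b l' -> l = l'.
Proof.
  intros H H'; apply (is_RInt_unique (V := R_CompleteNormedModule)) in H, H'.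
  now rewrite <- H.
Qed.

Lemma is_RInt_derive_R (F f : R -> R) a b :
  (forall t, is_derive F t (f t)) -> (forall t, ex_derive f t) ->
  is_RInt f a b (F b - F a).
Proof.
  intros HF Hf; apply (is_RInt_derive (V := R_CompleteNormedModule)); intros t _; [apply HF|].
  now apply (ex_derive_continuous (K := R_AbsRing) (V := R_NormedModule)).
Qed.

(** The antiderivative is [sin t * cos t ^ (2 n + 1)], which vanishes at both ends. *)
Lemma cos_moment_S n :
  2 * (INR n + 1) * cos_moment (S n) = (2 * INR n + 1) * cos_moment n.
Proof.
  assert (H : is_RInt (fun t => 2 * (INR n + 1) * cos t ^ (2 * S n)
      - (2 * INR n + 1) * cos t ^ (2 * n))
    0 (PI / 2) (sin (PI / 2) * cos (PI / 2) ^ (2 * n + 1) - sin 0 * cos 0 ^ (2 * n + 1))).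
  { apply (is_RInt_derive_R (fun t => sin t * cos t ^ (2 * n + 1))); [|intros t; auto_derive; easy].
    intros t; auto_derive; [easy|].
    (* Bring all exponents and coefficients to [2 * n] plus a constant. *)
    change (n + (n + 0))%nat with (2 * n)%nat.
    change (S (n + S (n + 0)))%nat with (2 * S n)%nat.
    change (n + S (n + 0))%nat with (pred (2 * S n))%nat.
    replace (2 * S n)%nat with (S (S (2 * n))) by lia.
    replace (pred (2 * n + 1)) with (2 * n)%nat by lia.
    replace (2 * n + 1)%nat with (S (2 * n)) by lia.
    change (match n with O => 1 | S _ => INR n + 1 end) with (INR (S n)).
    rewrite !(S_INR (2 * n)), mult_INR; cbn [pow].
    replace (INR 2) with 2 by (simpl; lra).
    generalize (sin2_cos2 t); unfold Rsqr; intros E.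
    replace (1 * - sin t) with (- sin t) by ring.
    set (c := cos t) in *; set (s := sin t) in *; set (p := c ^ (2 * n)).
    transitivity (c * (c * p) - (2 * INR n + 1) * p * (s * s)); [ring|].
    replace (s * s) with (1 - c * c) by lra; ring. }
  assert (E : is_RInt (fun t => 2 * (INR n + 1) * cos t ^ (2 * S n)
      - (2 * INR n + 1) * cos t ^ (2 * n))
    0 (PI / 2) (2 * (INR n + 1) * cos_moment (S n) - (2 * INR n + 1) * cos_moment n)).
  { exact (is_RInt_minus _ _ _ _ _ _
      (is_RInt_scal _ _ _ (2 * (INR n + 1)) _ (cos_moment_correct (S n)))
      (is_RInt_scal _ _ _ (2 * INR n + 1) _ (cos_moment_correct n))). }
  assert (E2 := is_RInt_inj _ _ _ _ _ E H).
  rewrite cos_PI2, sin_0, pow_i in E2 by lia; lra.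
Qed.

(** The antiderivative is
    [t * cos t ^ (2 n + 2) + (n + 1) * t ^ 2 * sin t * cos t ^ (2 n + 1)]: differentiating
    the power of the cosine in the first term cancels the derivative of [t ^ 2] in the second,
    so that only even cosine moments remain.  It vanishes at both ends. *)
Lemma sq_cos_moment_S n :
  cos_moment (S n) + 2 * (INR n + 1) ^ 2 * sq_cos_moment (S n) =
  (INR n + 1) * (2 * INR n + 1) * sq_cos_moment n.
Proof.
  assert (H : is_RInt (fun t => cos t ^ (2 * S n)
      + 2 * (INR n + 1) ^ 2 * (t ^ 2 * cos t ^ (2 * S n))
      - (INR n + 1) * (2 * INR n + 1) * (t ^ 2 * cos t ^ (2 * n)))
    0 (PI / 2)
    ((PI / 2 * cos (PI / 2) ^ (2 * S n)
      + (INR n + 1) * (PI / 2) ^ 2 * (sin (PI / 2) * cos (PI / 2) ^ (2 * n + 1)))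
     - (0 * cos 0 ^ (2 * S n) + (INR n + 1) * 0 ^ 2 * (sin 0 * cos 0 ^ (2 * n + 1))))).
  { apply (is_RInt_derive_R (fun t => t * cos t ^ (2 * S n)
      + (INR n + 1) * t ^ 2 * (sin t * cos t ^ (2 * n + 1)))); [|intros t; auto_derive; easy].
    intros t; auto_derive; [easy|].
    (* Bring all exponents and coefficients to [2 * n] plus a constant. *)
    change (n + (n + 0))%nat with (2 * n)%nat.
    change (S (n + S (n + 0)))%nat with (2 * S n)%nat.
    change (n + S (n + 0))%nat with (pred (2 * S n))%nat.
    replace (2 * S n)%nat with (S (S (2 * n))) by lia.
    replace (pred (2 * n + 1)) with (2 * n)%nat by lia.
    replace (2 * n + 1)%nat with (S (2 * n)) by lia.
    change (match n with O => 1 | S _ => INR n + 1 end) with (INR (S n)).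
    cbn [pred]; rewrite ?S_INR, mult_INR; cbn [pow].
    replace (INR 2) with 2 by (simpl; lra). simpl (INR 1).
    generalize (sin2_cos2 t); unfold Rsqr; intros E.
    set (c := cos t) in *; set (s := sin t) in *; set (p := c ^ (2 * n)).
    set (m := INR n).
    transitivity (c * (c * p) + (m + 1) * t * t * c * (c * p)
      - (m + 1) * t * t * (2 * m + 1) * p * (s * s)); [ring|].
    replace (s * s) with (1 - c * c) by lra; ring. }
  assert (E : is_RInt (fun t => cos t ^ (2 * S n)
      + 2 * (INR n + 1) ^ 2 * (t ^ 2 * cos t ^ (2 * S n))
      - (INR n + 1) * (2 * INR n + 1) * (t ^ 2 * cos t ^ (2 * n))) 0 (PI / 2)
    (cos_moment (S n) + 2 * (INR n + 1) ^ 2 * sq_cos_moment (S n)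
     - (INR n + 1) * (2 * INR n + 1) * sq_cos_moment n)).
  { exact (is_RInt_minus _ _ _ _ _ _ (is_RInt_plus _ _ _ _ _ _
      (cos_moment_correct (S n))
      (is_RInt_scal _ _ _ (2 * (INR n + 1) ^ 2) _ (sq_cos_moment_correct (S n))))
      (is_RInt_scal _ _ _ ((INR n + 1) * (2 * INR n + 1)) _ (sq_cos_moment_correct n))). }
  assert (E2 := is_RInt_inj _ _ _ _ _ E H).
  rewrite cos_PI2, sin_0, !pow_i in E2 by lia; lra.
Qed.

Lemma x_cos_le_sin t : 0 <= t <= PI / 2 -> 0 <= t * cos t <= sin t.
Proof.
  intros [H0 H1]; split.
  { apply Rmult_le_pos; [easy|]. apply cos_ge_0; lra. }
  (* The derivative of [sin u - u * cos u] is [u * sin u]. *)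
  destruct (MVT_gen (fun u => sin u - u * cos u) 0 t (fun u => u * sin u)) as [c [Hc E]].
  - intros x _; auto_derive; [easy|]; ring.
  - intros x _; apply derivable_continuous_pt. reg.
  - rewrite Rmin_left, Rmax_right in Hc by easy; rewrite sin_0 in E.
    assert (0 <= sin c) by (apply sin_ge_0; lra).
    assert (0 <= c * sin c * (t - 0)) by (repeat apply Rmult_le_pos; lra). lra.
Qed.

Lemma cos_moment_pos n : 0 < cos_moment n.
Proof.
  generalize PI_RGT_0; intros HP.
  apply RInt_gt_0; [lra| |].
  - intros x Hx. apply pow_lt, cos_gt_0; lra.
  - intros t _; apply (ex_derive_continuous (K := R_AbsRing) (V := R_NormedModule)).
    auto_derive; easy.
Qed.

(** Since [t * cos t <= sin t], two factors of the cosine absorb [t ^ 2]: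
    [t ^ 2 * cos t ^ (2 n + 2) <= sin t ^ 2 * cos t ^ (2 n)]. *)
Lemma sq_cos_moment_bound n :
  0 <= sq_cos_moment (S n) <= cos_moment n - cos_moment (S n).
Proof.
  generalize PI_RGT_0; intros HP; split.
  - apply RInt_ge_0; [lra| |].
    + eexists; apply sq_cos_moment_correct.
    + intros x Hx. apply Rmult_le_pos; apply pow_le; [lra|].
      apply cos_ge_0; lra.
  - apply (is_RInt_le (fun t => t ^ 2 * cos t ^ (2 * S n))
      (fun t => minus (cos t ^ (2 * n)) (cos t ^ (2 * S n))) 0 (PI / 2)); [lra| | |].
    + apply sq_cos_moment_correct.
    + apply (is_RInt_minus (V := R_NormedModule)); apply cos_moment_correct.
    + intros t Ht. destruct (x_cos_le_sin t) as [H1 H2]; [lra|].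
      replace (2 * S n)%nat with (S (S (2 * n))) by lia.
      unfold minus, plus, opp; cbn -[Nat.mul].
      generalize (sin2_cos2 t); unfold Rsqr; intros E.
      assert (0 <= cos t ^ (2 * n)) by (apply pow_le, cos_ge_0; lra).
      set (c := cos t) in *; set (s := sin t) in *; set (p := c ^ (2 * n)) in *.
      apply Rle_trans with (p * (t * c) ^ 2); [right; ring|].
      apply Rle_trans with (p * s ^ 2); [|right; replace (s ^ 2) with (1 - c * c); [ring | lra]].
      apply Rmult_le_compat_l; [easy|]. apply pow_incr; lra.
Qed.

Definition moment_ratio (n : nat) : R := sq_cos_moment n / cos_moment n.

(** Dividing the recurrence of [sq_cos_moment] by the one of [cos_moment] makes
    each inverse square a difference of consecutive ratios. *)
Lemma moment_ratio_S n :
  / (INR n + 1) ^ 2 = 2 * (moment_ratio n - moment_ratio (S n)).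
Proof.
  unfold moment_ratio.
  assert (H := cos_moment_S n). assert (H' := sq_cos_moment_S n).
  assert (P := cos_moment_pos n). assert (P' := cos_moment_pos (S n)).
  assert (N := pos_INR n).
  set (m := INR n) in *.
  replace (sq_cos_moment n)
    with ((cos_moment (S n) + 2 * (m + 1) ^ 2 * sq_cos_moment (S n))
      / ((m + 1) * (2 * m + 1)))
    by (rewrite H'; field; lra).
  replace (cos_moment n) with (2 * (m + 1) * cos_moment (S n) / (2 * m + 1))
    by (rewrite H; field; lra).
  field; repeat split; lra.
Qed.

Lemma moment_ratio_0 : moment_ratio 0 = PI ^ 2 / 12.
Proof.
  unfold moment_ratio.
  replace (cos_moment 0) with (PI / 2).
  replace (sq_cos_moment 0) with ((PI / 2) ^ 3 / 3).
  { generalize PI_RGT_0; intros; field; lra. }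
  - symmetry; apply (is_RInt_unique (V := R_CompleteNormedModule)).
    replace ((PI / 2) ^ 3 / 3) with ((PI / 2) ^ 3 / 3 - 0 ^ 3 / 3) by (simpl; lra).
    apply (is_RInt_derive_R (fun t => t ^ 3 / 3)); intros t; [|auto_derive; easy].
    auto_derive; [easy|]; simpl; field.
  - symmetry; apply (is_RInt_unique (V := R_CompleteNormedModule)).
    replace (PI / 2) with (PI / 2 - 0) at 2 by lra.
    apply (is_RInt_derive_R (fun t => t)); intros t; auto_derive; easy.
Qed.

Lemma moment_ratio_bound n : 0 <= moment_ratio (S n) <= / (INR n + 1).
Proof.
  unfold moment_ratio.
  assert (H := cos_moment_S n).
  assert (P := cos_moment_pos n). assert (P' := cos_moment_pos (S n)).
  assert (N := pos_INR n).
  destruct (sq_cos_moment_bound n) as [B0 B1].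
  split.
  - apply Rle_mult_inv_pos; easy.
  - apply Rle_div_l; [easy|].
    apply Rmult_le_reg_l with (INR n + 1); [lra|].
    replace ((INR n + 1) * (/ (INR n + 1) * cos_moment (S n)))
      with (cos_moment (S n)) by (field; lra).
    nra.
Qed.

Lemma is_lim_seq_inv_S : is_lim_seq (fun n => / (INR n + 1)) 0.
Proof.
  apply is_lim_seq_ext with (fun n => / INR (S n)).
  { intros n; now rewrite S_INR. }
  apply (is_lim_seq_incr_1 (fun n => / INR n)).
  now apply (is_lim_seq_inv INR p_infty is_lim_seq_INR).
Qed.

Lemma basel : is_series (fun k => / (INR k + 1) ^ 2) (PI ^ 2 / 6).
Proof.
  assert (Hsum : forall n, sum_n (fun k => / (INR k + 1) ^ 2) n
    = PI ^ 2 / 6 - 2 * moment_ratio (S n)).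
  { induction n.
    - rewrite sum_O, moment_ratio_S, moment_ratio_0; lra.
    - rewrite sum_Sn, IHn, moment_ratio_S; unfold plus; simpl; lra. }
  change (is_lim_seq (sum_n (fun k => / (INR k + 1) ^ 2)) (PI ^ 2 / 6)).
  apply is_lim_seq_ext with (fun n => PI ^ 2 / 6 - 2 * moment_ratio (S n)).
  { intros n; now rewrite Hsum. }
  replace (Finite (PI ^ 2 / 6)) with (Finite (PI ^ 2 / 6 - 2 * 0)) by (f_equal; lra).
  apply is_lim_seq_minus'; [apply is_lim_seq_const|].
  apply (is_lim_seq_scal_l _ 2 0).
  apply is_lim_seq_le_le with (fun _ => 0) (fun n => / (INR n + 1));
    [apply moment_ratio_bound | apply is_lim_seq_const | apply is_lim_seq_inv_S].
Qed.

(** * Bounds for the logarithm and a criterion for differentiability *)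

Lemma exp_le x y : x <= y -> exp x <= exp y.
Proof. intros [H | ->]; [now apply Rlt_le, exp_increasing | apply Rle_refl]. Qed.

Lemma ln_le_sub1 u : 0 < u -> ln u <= u - 1.
Proof.
  intros H; generalize (exp_ineq1_le (ln u)); rewrite exp_ln by easy; lra.
Qed.

Lemma ln_ge_1_sub_inv u : 0 < u -> 1 - / u <= ln u.
Proof.
  intros H; generalize (ln_le_sub1 (/ u) (Rinv_0_lt_compat _ H)).
  rewrite ln_Rinv by easy; lra.
Qed.

(** All the derivatives of limits below are obtained through this criterion: an
    increment is an explicit series, and its distance to the linear part is bounded by the square
    of the step times a convergent series. *)
Lemma is_derive_of_quadratic_error (f : R -> R) x l d C :
  0 < d ->
  (forall y, Rabs (y - x) < d -> Rabs (f y - f x - (y - x) * l) <= C * (y - x) ^ 2) ->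
  is_derive f x l.
Proof.
  intros Hd H; apply is_derive_Reals; intros eps Heps.
  set (C' := Rabs C + 1).
  assert (HC : 0 < C') by (unfold C'; generalize (Rabs_pos C); lra).
  assert (Hdel : 0 < Rmin d (eps / C')).
  { apply Rmin_pos; [easy|]. now apply Rdiv_lt_0_compat. }
  exists (mkposreal _ Hdel); intros h Hh0 Hh; simpl in Hh.
  assert (H1 := Rlt_le_trans _ _ _ Hh (Rmin_l _ _)).
  assert (H2 := Rlt_le_trans _ _ _ Hh (Rmin_r _ _)).
  specialize (H (x + h)); replace (x + h - x) with h in H by ring.
  specialize (H H1).
  replace ((f (x + h) - f x) / h - l) with ((f (x + h) - f x - h * l) / h) by (field; easy).
  unfold Rdiv; rewrite Rabs_mult, Rabs_inv.
  assert (Hp := Rabs_pos_lt _ Hh0).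
  apply Rlt_div_l; [easy|].
  apply Rle_lt_trans with (1 := H).
  apply Rlt_div_r in H2; [|easy].
  rewrite <- (pow2_abs h).
  apply Rle_lt_trans with (C' * Rabs h ^ 2); [|simpl; nra].
  apply Rmult_le_compat_r; [apply pow2_ge_0|]. unfold C'; generalize (Rle_abs C); lra.
Qed.

(** * The digamma and trigamma series *)

Lemma shift_pos x k : 0 < x -> 0 < x + INR k.
Proof. generalize (pos_INR k); lra. Qed.

(** Comparison with the shift 1, for which convergence is known from [basel]. *)
Lemma inv_shift_le x k : 0 < x -> / (x + INR k) <= / Rmin x 1 * / (INR k + 1).
Proof.
  intros Hx; rewrite <- Rinv_mult.
  assert (Hm : 0 < Rmin x 1) by (apply Rmin_pos; lra).
  assert (Hk := pos_INR k).
  apply Rinv_le_contravar; [nra|].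
  generalize (Rmin_l x 1) (Rmin_r x 1); nra.
Qed.

Lemma ex_series_inv_prod x y :
  0 < x -> 0 < y -> ex_series (fun k => / ((x + INR k) * (y + INR k))).
Proof.
  intros Hx Hy.
  apply (ex_series_le (V := R_CompleteNormedModule) _
    (fun k => / Rmin x 1 * / Rmin y 1 * / (INR k + 1) ^ 2)).
  - intros k; assert (X := shift_pos x k Hx); assert (Y := shift_pos y k Hy).
    rewrite Rinv_mult; change norm with Rabs; rewrite Rabs_pos_eq.
    + generalize (inv_shift_le x k Hx) (inv_shift_le y k Hy); intros A B.
      replace (/ Rmin x 1 * / Rmin y 1 * / (INR k + 1) ^ 2)
        with ((/ Rmin x 1 * / (INR k + 1)) * (/ Rmin y 1 * / (INR k + 1))).
      * apply Rmult_le_compat; try easy; now apply Rlt_le, Rinv_0_lt_compat.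
      * rewrite <- Rsqr_pow2, Rsqr_def, (Rinv_mult (INR k + 1)); ring.
    + apply Rmult_le_pos; now apply Rlt_le, Rinv_0_lt_compat.
  - apply (ex_series_scal (V := R_NormedModule)); eexists; apply basel.
Qed.

(** The classical series of [psi']; [Derive_psi] meets it at [x + 1], away from its poles. *)
Definition trigamma_series (x : R) : R := Series (fun k => / (x + INR k) ^ 2).

(** This is [psi] on the positive half-line, by [psi_gt_0].  The summands are arranged
    so that the series converges absolutely and vanishes at 1. *)
Definition digamma_series (x : R) : R :=
  - Euler_gamma + Series (fun k => / (INR k + 1) - / (x + INR k)).

Lemma trigamma_series_1 : trigamma_series 1 = PI ^ 2 / 6.
Proof.
  apply is_series_unique. generalize basel; apply is_series_ext.
  intros k; now rewrite Rplus_comm.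
Qed.

Lemma digamma_series_1 : digamma_series 1 = - Euler_gamma.
Proof.
  unfold digamma_series.
  rewrite (Series_ext _ (fun k => 0 * 0)).
  - rewrite Series_scal_l; ring.
  - intros k; rewrite Rplus_comm; ring.
Qed.

Lemma ex_trigamma_series x : 0 < x -> ex_series (fun k => / (x + INR k) ^ 2).
Proof.
  intros Hx; generalize (ex_series_inv_prod x x Hx Hx); apply ex_series_ext.
  intros k; f_equal; ring.
Qed.

Lemma inv_sub_shift x y k : 0 < x -> 0 < y ->
  / (x + INR k) - / (y + INR k) = (y - x) * / ((x + INR k) * (y + INR k)).
Proof.
  intros Hx Hy; assert (X := shift_pos x k Hx); assert (Y := shift_pos y k Hy).
  field; lra.
Qed.

Lemma ex_inv_sub_series x y : 0 < x -> 0 < y ->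
  ex_series (fun k => / (x + INR k) - / (y + INR k)).
Proof.
  intros Hx Hy.
  apply ex_series_ext with (fun k => (y - x) * / ((x + INR k) * (y + INR k))).
  { intros k; now rewrite inv_sub_shift. }
  now apply (ex_series_scal (V := R_NormedModule)), ex_series_inv_prod.
Qed.

Lemma ex_digamma_series x : 0 < x -> ex_series (fun k => / (INR k + 1) - / (x + INR k)).
Proof.
  intros Hx; generalize (ex_inv_sub_series 1 x Rlt_0_1 Hx); apply ex_series_ext.
  intros k; now rewrite (Rplus_comm 1).
Qed.

Lemma digamma_series_sub x y : 0 < x -> 0 < y ->
  digamma_series y - digamma_series x =
  (y - x) * Series (fun k => / ((x + INR k) * (y + INR k))).
Proof.
  intros Hx Hy. unfold digamma_series.
  rewrite <- Series_scal_l.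
  rewrite (Series_ext (fun k => (y - x) * _)
    (fun k => (/ (INR k + 1) - / (y + INR k)) - (/ (INR k + 1) - / (x + INR k)))).
  - rewrite (Series_minus (fun k => / (INR k + 1) - / (y + INR k)))
      by now apply ex_digamma_series.
    ring.
  - intros k; rewrite <- inv_sub_shift by easy; ring.
Qed.

Lemma Series_ge_0 (a : nat -> R) : (forall n, 0 <= a n) -> ex_series a -> 0 <= Series a.
Proof.
  intros H Ha; replace 0 with (Series (fun _ => 0 * 0)) by (rewrite Series_scal_l; ring).
  apply Series_le; [|easy]; intros n; specialize (H n); lra.
Qed.

Lemma Series_inv_prod_le m x y : 0 < m -> m <= x -> m <= y ->
  0 <= Series (fun k => / ((x + INR k) * (y + INR k))) <= trigamma_series m.
Proof.
  intros Hm Hx Hy.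
  assert (B : forall k, 0 <= / ((x + INR k) * (y + INR k)) <= / (m + INR k) ^ 2).
  { intros k; assert (X := shift_pos m k Hm); split.
    - apply Rlt_le, Rinv_0_lt_compat; nra.
    - apply Rinv_le_contravar; nra. }
  split.
  - apply Series_ge_0; [|apply ex_series_inv_prod; lra].
    intros k; generalize (B k); lra.
  - apply Series_le; [easy|]; now apply ex_trigamma_series.
Qed.

Lemma digamma_series_le x y : 0 < x -> x <= y -> digamma_series x <= digamma_series y.
Proof.
  intros Hx Hy.
  assert (E := digamma_series_sub x y Hx ltac:(lra)).
  destruct (Series_inv_prod_le x x y) as [B _]; [lra..|].
  nra.
Qed.

(** By [digamma_series_sub] the error is
    [- (y - x) ^ 2] times the sum of [/ ((y + k) * (x + k) ^ 2)], which stays bounded for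
    [y > x / 2]. *)
Lemma is_derive_digamma_series x : 0 < x ->
  is_derive digamma_series x (trigamma_series x).
Proof.
  intros Hx.
  apply is_derive_of_quadratic_error with (x / 2) (2 / x * trigamma_series (x / 2)); [lra|].
  intros y Hy; apply Rabs_lt_between in Hy.
  rewrite digamma_series_sub by lra.
  unfold trigamma_series at 1.
  rewrite <- Rmult_minus_distr_l, <- Series_minus;
    [|apply ex_series_inv_prod; lra | apply ex_trigamma_series; lra].
  assert (E : forall k, / ((x + INR k) * (y + INR k)) - / (x + INR k) ^ 2
     = - (y - x) * (/ (y + INR k) * / (x + INR k) ^ 2)).
  { intros k; assert (X := shift_pos x k Hx); assert (Y := shift_pos y k ltac:(lra)).
    field; lra. }
  rewrite (Series_ext _ _ E), Series_scal_l.
  assert (B : 0 <= Series (fun k => / (y + INR k) * / (x + INR k) ^ 2)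
    <= 2 / x * trigamma_series (x / 2)).
  { assert (B' : forall k, 0 <= / (y + INR k) * / (x + INR k) ^ 2
      <= 2 / x * / (x / 2 + INR k) ^ 2).
    { intros k; assert (X := shift_pos (x / 2) k ltac:(lra)).
      assert (P := pos_INR k). split.
      - rewrite <- Rinv_mult; apply Rlt_le, Rinv_0_lt_compat.
        apply Rmult_lt_0_compat; [lra|]. apply pow_lt; lra.
      - apply Rmult_le_compat.
        + apply Rlt_le, Rinv_0_lt_compat; lra.
        + apply Rlt_le, Rinv_0_lt_compat, pow_lt; lra.
        + replace (2 / x) with (/ (x / 2)) by (field; lra).
          apply Rinv_le_contravar; lra.
        + apply Rinv_le_contravar; [apply pow_lt; lra|]. apply pow_incr; lra. }
    unfold trigamma_series; rewrite <- Series_scal_l; split.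
    - apply Series_ge_0.
      + intros k; generalize (B' k); lra.
      + apply (ex_series_le (V := R_CompleteNormedModule) _
          (fun k => 2 / x * / (x / 2 + INR k) ^ 2)).
        * intros k; change norm with Rabs; rewrite Rabs_pos_eq; apply B'.
        * apply (ex_series_scal (V := R_NormedModule)), ex_trigamma_series; lra.
    - apply Series_le; [easy|].
      apply (ex_series_scal (V := R_NormedModule)), ex_trigamma_series; lra. }
  set (S := Series _) in *.
  replace ((y - x) * (- (y - x) * S)) with (- ((y - x) ^ 2 * S)) by ring.
  rewrite Rabs_Ropp, Rabs_pos_eq.
  - rewrite Rmult_comm; apply Rmult_le_compat_r; [apply pow2_ge_0 | lra].
  - apply Rmult_le_pos; [apply pow2_ge_0 | lra].
Qed.

Lemma is_lim_seq_inv_shift x : 0 < x -> is_lim_seq (fun n => / (x + INR n)) 0.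
Proof.
  intros Hx.
  apply is_lim_seq_le_le with (fun _ => 0) (fun n => / Rmin x 1 * / (INR n + 1)).
  - intros n; split; [|now apply inv_shift_le].
    now apply Rlt_le, Rinv_0_lt_compat, shift_pos.
  - apply is_lim_seq_const.
  - replace (Finite 0) with (Rbar_mult (/ Rmin x 1) 0) by (simpl; f_equal; ring).
    apply is_lim_seq_scal_l, is_lim_seq_inv_S.
Qed.

(** The summand is [/ (x + k) - / (x + (k + 1))]. *)
Lemma Series_telescope x : 0 < x ->
  Series (fun k => / ((x + INR k) * (x + 1 + INR k))) = / x.
Proof.
  intros Hx; apply is_series_unique.
  change (is_lim_seq (sum_n (fun k => / ((x + INR k) * (x + 1 + INR k)))) (/ x)).
  apply is_lim_seq_ext with (fun n => / x - / (x + INR (S n))).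
  - induction n.
    + rewrite sum_O; simpl; field; lra.
    + rewrite sum_Sn, <- IHn; unfold plus; simpl (AbelianMonoid.plus _ _).
      assert (P := pos_INR n); change plus with Rplus; rewrite !S_INR; field; lra.
  - replace (Finite (/ x)) with (Finite (/ x - 0)) by (f_equal; ring).
    apply is_lim_seq_minus'; [apply is_lim_seq_const|].
    apply -> (is_lim_seq_incr_1 (fun n => / (x + INR n))).
    now apply is_lim_seq_inv_shift.
Qed.

Lemma digamma_series_incr_1 x : 0 < x -> digamma_series (x + 1) = digamma_series x + / x.
Proof.
  intros Hx; assert (E := digamma_series_sub x (x + 1) Hx ltac:(lra)).
  rewrite Series_telescope in E by easy; lra.
Qed.

(** Each square [(x + k) ^ 2] is at most [(x + k) * (x + 1 + k)], and the latter
    inverses telescope. *)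
Lemma trigamma_series_ge_inv x : 0 < x -> / x <= trigamma_series x.
Proof.
  intros Hx; rewrite <- Series_telescope by easy.
  apply (Series_inv_prod_le x x (x + 1)); lra.
Qed.

Lemma trigamma_series_ge_inv_sq x : 0 < x -> / x ^ 2 <= trigamma_series x.
Proof.
  intros Hx; unfold trigamma_series; rewrite Series_incr_1 by now apply ex_trigamma_series.
  change (INR 0) with 0; rewrite Rplus_0_r.
  enough (0 <= Series (fun k => / (x + INR (S k)) ^ 2)) by lra.
  apply Series_ge_0.
  - intros k.
    apply Rlt_le, Rinv_0_lt_compat, pow_lt, shift_pos, Hx.
  - apply -> (ex_series_incr_1 (V := R_NormedModule) (fun k => / (x + INR k) ^ 2)).
    now apply ex_trigamma_series.
Qed.

(** The sequence that defines Euler's constant decreases and is nonnegative,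
    because each increment of the logarithm over [(n + 1, n + 2)] lies between the inverses of the
    two ends. *)
Lemma is_lim_seq_Euler_gamma :
  is_lim_seq (fun n => sum_n (fun k => / (INR k + 1)) n - ln (INR n + 1)) Euler_gamma.
Proof.
  set (u := fun n => sum_n (fun k => / (INR k + 1)) n - ln (INR n + 1)).
  assert (E : Euler_gamma = real (Lim_seq u)).
  { unfold Euler_gamma; f_equal; apply Lim_seq_ext; intros n; unfold u.
    rewrite sum_n_Reals, S_INR; f_equal; apply sum_eq; intros k _; now rewrite S_INR. }
  assert (D : forall n, 0 <= ln (INR n + 1 + 1) - ln (INR n + 1) - / (INR n + 1 + 1)
     /\ ln (INR n + 1 + 1) - ln (INR n + 1) <= / (INR n + 1)).
  { intros n; assert (P := pos_INR n).
    rewrite <- ln_div by lra.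
    assert (Q : 0 < (INR n + 1 + 1) / (INR n + 1)) by (apply Rdiv_lt_0_compat; lra).
    split.
    - apply Rle_trans with (1 - / ((INR n + 1 + 1) / (INR n + 1)) - / (INR n + 1 + 1)).
      + right; field; lra.
      + generalize (ln_ge_1_sub_inv _ Q); lra.
    - apply Rle_trans with (1 := ln_le_sub1 _ Q). right; field; lra. }
  assert (L : forall n, ln (INR n + 1 + 1) <= sum_n (fun k => / (INR k + 1)) n).
  { induction n.
    - rewrite sum_O; generalize (D 0%nat); simpl; replace (0 + 1) with 1 by ring; rewrite ln_1; lra.
    - rewrite sum_Sn; change plus with Rplus; generalize (D (S n)); rewrite !S_INR; lra. }
  rewrite E; apply Lim_seq_correct', ex_finite_lim_seq_decr with 0; unfold u; intros n.
  - rewrite sum_Sn; change plus with Rplus; generalize (D n); rewrite !S_INR; lra.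
  - assert (0 < / (INR n + 1 + 1)) by (apply Rinv_0_lt_compat; generalize (pos_INR n); lra).
    generalize (L n) (D n); lra.
Qed.

(** This form of the digamma function matches the functional equation of
    [ln_Gamma], which produces sums of [ln (x + k)]. *)
Lemma is_lim_seq_digamma_series x : 0 < x ->
  is_lim_seq (fun n => ln (INR n + 1) - sum_n (fun k => / (x + INR k)) n) (digamma_series x).
Proof.
  intros Hx.
  apply is_lim_seq_ext with (fun n =>
    - (sum_n (fun k => / (INR k + 1)) n - ln (INR n + 1))
    + sum_n (fun k => / (INR k + 1) - / (x + INR k)) n).
  { induction n; [rewrite !sum_O; ring|].
    rewrite !sum_Sn; change plus with Rplus; lra. }
  unfold digamma_series; apply is_lim_seq_plus'.
  - apply (is_lim_seq_opp _ Euler_gamma), is_lim_seq_Euler_gamma.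
  - apply (Series_correct (fun k => / (INR k + 1) - / (x + INR k))), ex_digamma_series, Hx.
Qed.

(** The sum of [/ (x + k)] for [k <= n] dominates [ln (x + n + 1) - ln x]. *)
Lemma digamma_series_le_ln x : 0 < x -> digamma_series x <= ln x.
Proof.
  intros Hx.
  assert (B : forall n, ln (INR n + 1) - sum_n (fun k => / (x + INR k)) n <= ln x).
  { intros n; enough (ln (x + INR n + 1) - ln x <= sum_n (fun k => / (x + INR k)) n).
    { assert (ln (INR n + 1) <= ln (x + INR n + 1)); [|lra].
      generalize (pos_INR n); intros; apply ln_le; lra. }
    induction n.
    - rewrite sum_O; simpl INR; rewrite !Rplus_0_r, <- ln_div by lra.
      eapply Rle_trans; [apply ln_le_sub1, Rdiv_lt_0_compat; lra|].
      right; field; lra.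
    - rewrite sum_Sn; change plus with Rplus; rewrite S_INR.
      assert (P := pos_INR n).
      enough (ln (x + (INR n + 1) + 1) - ln (x + INR n + 1) <= / (x + (INR n + 1))) by lra.
      rewrite <- ln_div by lra.
      eapply Rle_trans; [apply ln_le_sub1, Rdiv_lt_0_compat; lra|].
      right; field; lra. }
  apply (is_lim_seq_le _ _ _ _ B (is_lim_seq_digamma_series x Hx) (is_lim_seq_const _)).
Qed.

(** * Integrals of nonnegative functions over the positive half-line *)

Notation is_RInt_pos f l :=
  (is_RInt_gen (V := R_NormedModule) f (at_right 0) (Rbar_locally p_infty) l).

Lemma at_right_0_lt c : 0 < c -> at_right 0 (fun a => 0 < a < c).
Proof.
  intros Hc; exists (mkposreal c Hc); intros y Hy Hy0.
  apply Rabs_lt_between in Hy; unfold minus, plus, opp in Hy; simpl in Hy; lra.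
Qed.

(** Statements about the improper integral only need intervals [[a, b]] with
    [0 < a < b]. *)
Lemma filter_prod_pos_le :
  filter_prod (at_right 0) (Rbar_locally p_infty)
    (fun ab => 0 < fst ab /\ fst ab < snd ab).
Proof.
  apply Filter_prod with (fun a => 0 < a < 1) (fun b => 1 < b).
  - apply at_right_0_lt, Rlt_0_1.
  - now exists 1.
  - simpl; intros; lra.
Qed.

(** The integrals over [[a, b]] increase when the interval grows, so they converge to
    their supremum. *)
Lemma is_RInt_pos_bounded (f : R -> R) M :
  (forall t, 0 < t -> continuous f t) -> (forall t, 0 < t -> 0 <= f t) ->
  (forall a b, 0 < a -> a <= b -> RInt f a b <= M) ->
  exists l, is_RInt_pos f l /\ forall a b, 0 < a -> a <= b -> RInt f a b <= l.
Proof.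
  intros Hc Hp HM.
  assert (Hex : forall a b, 0 < a -> a <= b -> ex_RInt f a b).
  { intros a b Ha Hab; apply (ex_RInt_continuous (V := R_CompleteNormedModule)).
    intros z; rewrite Rmin_left by easy; intros Hz; apply Hc; lra. }
  assert (Hnn : forall a b, 0 < a -> a <= b -> 0 <= RInt f a b).
  { intros a b Ha Hab; apply RInt_ge_0; [easy | now apply Hex |].
    intros t Ht; apply Hp; lra. }
  destruct (completeness (fun v => exists a b, 0 < a /\ a <= b /\ v = RInt f a b))
    as [l [Hub Hlub]].
  { exists M; intros v (a & b & Ha & Hab & ->); now apply HM. }
  { exists (RInt f 1 1), 1, 1; repeat split; lra. }
  assert (Hle : forall a b, 0 < a -> a <= b -> RInt f a b <= l).
  { intros a b Ha Hab; apply Hub; now exists a, b. }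
  exists l; split; [|easy].
  intros P [eps HP].
  destruct (Classical_Prop.classic (exists a b, 0 < a /\ a <= b /\ l - eps < RInt f a b))
    as [(a0 & b0 & Ha0 & Hab0 & H0)|Hno].
  2:{ exfalso; assert (l <= l - eps); [|generalize (cond_pos eps); lra].
      apply Hlub; intros v (a & b & Ha & Hab & ->).
      apply Rnot_lt_le; intros H; apply Hno; now exists a, b. }
  apply Filter_prod with (fun a => 0 < a < a0) (fun b => b0 < b).
  - now apply at_right_0_lt.
  - now exists b0.
  - intros a b Ha Hb; simpl; exists (RInt f a b); split.
    { apply (RInt_correct (V := R_CompleteNormedModule)), Hex; lra. }
    apply HP.
    assert (E : RInt f a b = RInt f a a0 + RInt f a0 b0 + RInt f b0 b).
    { rewrite <- (RInt_Chasles (V := R_CompleteNormedModule) f a b0 b);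
        [|apply Hex; lra..].
      rewrite <- (RInt_Chasles (V := R_CompleteNormedModule) f a a0 b0);
        [|apply Hex; lra..]. easy. }
    assert (L := Hle a b ltac:(lra) ltac:(lra)).
    assert (L1 := Hnn a a0 ltac:(lra) ltac:(lra)).
    assert (L2 := Hnn b0 b ltac:(lra) ltac:(lra)).
    change (Rabs (RInt f a b - l) < eps). apply Rabs_def1; generalize (cond_pos eps); lra.
Qed.

Lemma is_RInt_pos_ge_0 (f : R -> R) l :
  (forall t, 0 < t -> 0 <= f t) -> is_RInt_pos f l -> 0 <= l.
Proof.
  intros Hp Hl; apply Rnot_lt_le; intros Hneg.
  assert (HP : locally l (fun z => z < 0)) by now apply (open_lt 0 l).
  specialize (Hl _ HP).
  destruct (filter_ex (F := filter_prod (at_right 0) (Rbar_locally p_infty)) _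
    (filter_and _ _ filter_prod_pos_le Hl)) as [[a b] [[Ha Hab] [z [Hz Hz0]]]]; simpl in *.
  assert (0 <= z); [|lra].
  apply (is_RInt_ge_0 f a b); [lra | easy |]. intros; apply Hp; lra.
Qed.

Lemma is_RInt_pos_le (f g : R -> R) lf lg :
  (forall t, 0 < t -> f t <= g t) -> is_RInt_pos f lf -> is_RInt_pos g lg -> lf <= lg.
Proof.
  intros H Hf Hg.
  assert (D := is_RInt_gen_minus _ _ _ _ Hg Hf).
  apply is_RInt_pos_ge_0 in D.
  - unfold minus, plus, opp in D; simpl in D; lra.
  - intros t Ht; specialize (H t Ht); unfold minus, plus, opp; simpl; lra.
Qed.

Lemma is_RInt_pos_inj (f : R -> R) l l' : is_RInt_pos f l -> is_RInt_pos f l' -> l = l'.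
Proof.
  intros H H'; apply Rle_antisym;
    eapply is_RInt_pos_le; try eassumption; intros; apply Rle_refl.
Qed.

Lemma is_RInt_pos_derive (F f : R -> R) la lb :
  (forall t, 0 < t -> is_derive F t (f t)) -> (forall t, 0 < t -> continuous f t) ->
  filterlim F (at_right 0) (locally la) ->
  filterlim F (Rbar_locally p_infty) (locally lb) ->
  is_RInt_pos f (lb - la).
Proof.
  intros HF Hf Ha Hb P [eps HP].
  assert (He : 0 < eps / 2) by (generalize (cond_pos eps); lra).
  apply Filter_prod with (fun a => 0 < a < 1 /\ ball la (mkposreal _ He) (F a))
    (fun b => 1 < b /\ ball lb (mkposreal _ He) (F b)).
  - apply filter_and; [apply at_right_0_lt, Rlt_0_1|]. apply Ha, locally_ball.
  - apply filter_and; [now exists 1|]. apply Hb, locally_ball.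
  - intros a b [Hpa Hba] [Hpb Hbb]; simpl; exists (F b - F a); split.
    + apply (is_RInt_derive (V := R_CompleteNormedModule)); intros t;
        rewrite Rmin_left by lra; intros Ht; [apply HF | apply Hf]; lra.
    + apply HP. change (Rabs (F a - la) < eps / 2) in Hba.
      change (Rabs (F b - lb) < eps / 2) in Hbb.
      change (Rabs ((F b - F a) - (lb - la)) < eps).
      apply Rabs_def2 in Hba, Hbb; apply Rabs_def1; lra.
Qed.

(** * Euler's integral *)

Definition gamma_integrand (x t : R) : R := Rpower t (x - 1) * exp (- t).

Lemma gamma_integrand_exp x t : gamma_integrand x t = exp ((x - 1) * ln t - t).
Proof. unfold gamma_integrand, Rpower; rewrite <- exp_plus; f_equal; ring. Qed.

Lemma gamma_integrand_pos x t : 0 < gamma_integrand x t.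
Proof. rewrite gamma_integrand_exp; apply exp_pos. Qed.

Lemma continuous_gamma_integrand x t : 0 < t -> continuous (gamma_integrand x) t.
Proof.
  intros Ht.
  apply (continuous_ext (fun t => exp ((x - 1) * ln t - t))).
  { intros; now rewrite gamma_integrand_exp. }
  apply (ex_derive_continuous (K := R_AbsRing) (V := R_NormedModule)).
  auto_derive; easy.
Qed.

(** The maximum of [(x + 1) * ln (1 + t) - t] over [t], attained at [t = x]. *)
Definition growth_cst (x : R) : R := (x + 1) * ln (x + 1) - x.

Lemma ln_growth x t : 0 < x -> 0 < t -> (x + 1) * ln (1 + t) - t <= growth_cst x.
Proof.
  intros Hx Ht; unfold growth_cst.
  assert (H := ln_le_sub1 ((1 + t) / (x + 1)) ltac:(apply Rdiv_lt_0_compat; lra)).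
  rewrite ln_div in H by lra.
  apply Rmult_le_compat_l with (r := x + 1) in H; [|lra].
  replace ((x + 1) * ((1 + t) / (x + 1) - 1)) with (t - x) in H by (field; lra). lra.
Qed.

(** The exponential beats [(1 + t) ^ (x + 1)] up to a constant [C], so the integrand is
    at most [C * (t / (1 + t)) ^ (x - 1) / (1 + t) ^ 2].  This is the derivative of
    [C / x * (t / (1 + t)) ^ x], which is bounded on the whole half-line: one antiderivative
    settles convergence at both ends. *)
Lemma RInt_gamma_integrand_le x a b : 0 < x -> 0 < a -> a <= b ->
  RInt (gamma_integrand x) a b <= exp (growth_cst x) / x.
Proof.
  intros Hx Ha Hab.
  set (C := exp (growth_cst x)).
  (* [W t] is [C / x * (t / (1 + t)) ^ x]. *)
  set (W := fun t => C / x * exp (x * (ln t - ln (1 + t)))).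
  assert (HC : 0 < C) by apply exp_pos.
  apply Rle_trans with (W b - W a).
  - apply (is_RInt_le (gamma_integrand x)
      (fun t => C * exp (x * (ln t - ln (1 + t))) * / (t * (1 + t))) a b); [easy| | |].
    + apply (RInt_correct (V := R_CompleteNormedModule)).
      apply (ex_RInt_continuous (V := R_CompleteNormedModule)); intros z.
      rewrite Rmin_left by easy; intros Hz; apply continuous_gamma_integrand; lra.
    + apply (is_RInt_derive (V := R_CompleteNormedModule)); intros t;
        rewrite Rmin_left by easy; intros Ht.
      * unfold W; auto_derive; [split; [lra|]; split; [lra | easy]|]. unfold Rminus; field; lra.
      * apply (ex_derive_continuous (K := R_AbsRing) (V := R_NormedModule)).
        auto_derive; repeat split; try lra. apply Rgt_not_eq; nra.
    + intros t Ht. assert (G := ln_growth x t Hx ltac:(lra)).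
      replace (/ (t * (1 + t))) with (exp (- ln t - ln (1 + t))).
      * rewrite gamma_integrand_exp; unfold C; rewrite <- !exp_plus.
        apply exp_le; lra.
      * replace (- ln t - ln (1 + t)) with (- (ln t + ln (1 + t))) by ring.
        rewrite exp_Ropp, exp_plus, !exp_ln by lra; easy.
  - assert (HCx : 0 < C / x) by now apply Rdiv_lt_0_compat.
    assert (0 < W a) by (apply Rmult_lt_0_compat; [easy | apply exp_pos]).
    assert (W b <= C / x * exp 0).
    { apply Rmult_le_compat_l; [lra|]. apply exp_le.
      assert (ln b <= ln (1 + b)) by (apply ln_le; lra). nra. }
    rewrite exp_0 in *; lra.
Qed.

Lemma Gamma_integral_aux x : 0 < x ->
  is_RInt_pos (gamma_integrand x) (Gamma_integral x) /\ 0 < Gamma_integral x.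
Proof.
  intros Hx.
  destruct (is_RInt_pos_bounded (gamma_integrand x) (exp (growth_cst x) / x)) as [l [Hl Hle]].
  - intros; now apply continuous_gamma_integrand.
  - intros; apply Rlt_le, gamma_integrand_pos.
  - intros; now apply RInt_gamma_integrand_le.
  - assert (E : Gamma_integral x = l)
      by exact (is_RInt_gen_unique (V := R_CompleteNormedModule) (Fa := at_right 0)
        (Fb := Rbar_locally p_infty) (gamma_integrand x) l Hl).
    rewrite E; split; [easy|].
    apply Rlt_le_trans with (RInt (gamma_integrand x) 1 2); [|apply Hle; lra].
    apply RInt_gt_0; [lra | intros; apply gamma_integrand_pos |].
    intros; apply continuous_gamma_integrand; lra.
Qed.

Lemma Gamma_integral_correct x : 0 < x ->
  is_RInt_pos (gamma_integrand x) (Gamma_integral x).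
Proof. apply Gamma_integral_aux. Qed.

Lemma Gamma_integral_pos x : 0 < x -> 0 < Gamma_integral x.
Proof. apply Gamma_integral_aux. Qed.

(** Integration by parts; [t ^ x * exp (- t)] vanishes at both ends of the
    half-line. *)
Lemma Gamma_integral_incr_1 x : 0 < x -> Gamma_integral (x + 1) = x * Gamma_integral x.
Proof.
  intros Hx.
  assert (Hx1 : 0 < x + 1) by lra.
  set (F := fun t => exp (x * ln t - t)).
  assert (H : is_RInt_pos (fun t => x * gamma_integrand x t - gamma_integrand (x + 1) t) (0 - 0)).
  { apply (is_RInt_pos_derive F).
    - intros t Ht; unfold F; rewrite !gamma_integrand_exp.
      auto_derive; [easy|].
      replace ((x - 1) * ln t - t) with ((x * ln t - t) + - ln t) by ring.
      rewrite (exp_plus (x * ln t - t)), (exp_Ropp (ln t)), exp_ln by easy.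
      replace ((x + 1 - 1) * ln t - t) with (x * ln t - t) by ring.
      unfold Rminus; field; lra.
    - intros t Ht.
      apply (continuous_minus (V := R_NormedModule) (fun t => x * gamma_integrand x t)).
      + apply (continuous_scal_r (V := R_NormedModule) x), continuous_gamma_integrand, Ht.
      + apply continuous_gamma_integrand, Ht.
    - apply (filterlim_le_le (F := at_right 0) (fun _ => 0) F
        (fun t => exp (x * ln t)) (Finite 0)).
      + generalize (at_right_0_lt 1 Rlt_0_1); apply filter_imp; intros t Ht; unfold F.
        split; [apply Rlt_le, exp_pos | apply exp_le; lra].
      + apply filterlim_const.
      + assert (E : Rbar_mult x m_infty = m_infty).
        { simpl; destruct (Rle_dec 0 x) as [H|H]; [|lra].
          destruct (Rle_lt_or_eq_dec 0 x H); [easy | lra]. }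
        assert (L := filterlim_comp _ _ _ _ _ _ _ _ is_lim_ln_0 (filterlim_Rbar_mult_l x m_infty)).
        rewrite E in L; exact (filterlim_comp _ _ _ _ _ _ _ _ L is_lim_exp_m).
    - apply (filterlim_le_le (F := Rbar_locally p_infty) (fun _ => 0) F
        (fun t => exp (growth_cst x) * / t) (Finite 0)).
      + exists 0; intros t Ht; unfold F; split; [apply Rlt_le, exp_pos|].
        rewrite <- (exp_ln t) at 3 by easy; rewrite <- exp_Ropp, <- exp_plus.
        apply exp_le; assert (G := ln_growth x t Hx Ht).
        assert (ln t <= ln (1 + t)) by (apply ln_le; lra). nra.
      + apply filterlim_const.
      + replace (Finite 0) with (Rbar_mult (exp (growth_cst x)) (Rbar_inv p_infty))
          by (simpl; f_equal; ring).
        eapply filterlim_comp; [now apply filterlim_Rbar_inv | apply filterlim_Rbar_mult_l]. }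
  assert (D := is_RInt_gen_minus _ _ _ _
    (is_RInt_gen_scal _ x _ (Gamma_integral_correct x Hx))
    (Gamma_integral_correct (x + 1) Hx1)).
  assert (E := is_RInt_pos_inj _ _ _ D H).
  unfold minus, plus, opp, scal, mult in E; simpl in E; unfold mult in E; simpl in E; lra.
Qed.

(** Concavity of [u ^ s] for [s] in [[0, 1]]: at [u = t / y] it lies below its tangent
    line at 1.  The bound becomes linear in [t], hence integrable against the gamma density. *)
Lemma power_le_chord s t y : 0 < y -> 0 < t -> 0 <= s <= 1 ->
  exp (s * ln t) <= exp (s * ln y) * (1 - s + s * (t / y)).
Proof.
  intros Hy Ht Hs.
  assert (Hu : 0 < t / y) by now apply Rdiv_lt_0_compat.
  (* [m] is the weighted mean of [t / y] and 1; adding the tangent-line bounds of the logarithm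
     at [m] with weights [s] and [1 - s] makes the linear parts cancel. *)
  set (m := 1 - s + s * (t / y)).
  assert (Hm : 0 < m) by (unfold m; destruct (Req_dec s 0) as [->|]; nra).
  rewrite <- (exp_ln m), <- exp_plus by easy; apply exp_le.
  assert (A := ln_le_sub1 (t / y / m) ltac:(now apply Rdiv_lt_0_compat)).
  assert (B := ln_le_sub1 (1 / m) ltac:(apply Rdiv_lt_0_compat; lra)).
  rewrite ln_div, ln_div in A by easy.
  rewrite ln_div, ln_1 in B by lra.
  assert (E : s * (t / y / m) + (1 - s) * (1 / m) = 1).
  { replace (s * (t / y / m) + (1 - s) * (1 / m)) with (m / m); [now field; lra|].
    unfold m at 1; field; lra. }
  nra.
Qed.

(** Wendel's inequality: a consequence of log-convexity, here obtained by
    integrating [power_le_chord]. *)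
Lemma Gamma_integral_add_le y s : 0 < y -> 0 <= s <= 1 ->
  Gamma_integral (y + s) <= exp (s * ln y) * Gamma_integral y.
Proof.
  intros Hy Hs.
  assert (Hy1 : 0 < y + 1) by lra; assert (Hys : 0 < y + s) by lra.
  assert (D := is_RInt_gen_plus _ _ _ _
    (is_RInt_gen_scal _ (exp (s * ln y) * (1 - s)) _ (Gamma_integral_correct y Hy))
    (is_RInt_gen_scal _ (exp (s * ln y) * s / y) _ (Gamma_integral_correct (y + 1) Hy1))).
  apply Rle_trans with (exp (s * ln y) * (1 - s) * Gamma_integral y
    + exp (s * ln y) * s / y * Gamma_integral (y + 1)).
  - apply (fun H => is_RInt_pos_le _ _ _ _ H (Gamma_integral_correct (y + s) Hys) D).
    intros t Ht; unfold plus, scal, mult; simpl; unfold mult; simpl.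
    assert (W := power_le_chord s t y Hy Ht Hs).
    rewrite !gamma_integrand_exp.
    replace ((y + s - 1) * ln t - t) with (((y - 1) * ln t - t) + s * ln t) by ring.
    replace ((y + 1 - 1) * ln t - t) with (((y - 1) * ln t - t) + ln t) by ring.
    rewrite !exp_plus, (exp_ln t) by easy.
    set (g := exp ((y - 1) * ln t - t)); assert (0 < g) by apply exp_pos.
    apply Rle_trans with (1 := Rmult_le_compat_l g _ _ ltac:(lra) W).
    right; field; lra.
  - right; rewrite Gamma_integral_incr_1 by easy; field; lra.
Qed.

(** * The logarithmic derivative of Euler's integral *)

Definition ln_Gamma (x : R) : R := ln (Gamma_integral x).

Lemma ln_Gamma_incr_1 x : 0 < x -> ln_Gamma (x + 1) = ln_Gamma x + ln x.
Proof.
  intros Hx; unfold ln_Gamma; rewrite Gamma_integral_incr_1, ln_mult by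
    (try apply Gamma_integral_pos; easy); ring.
Qed.

Lemma ln_Gamma_add_le y s : 0 < y -> 0 <= s <= 1 -> ln_Gamma (y + s) - ln_Gamma y <= s * ln y.
Proof.
  intros Hy Hs; unfold ln_Gamma.
  assert (P := Gamma_integral_pos y Hy).
  assert (P' := Gamma_integral_pos (y + s) ltac:(lra)).
  assert (L := ln_le _ _ P' (Gamma_integral_add_le y s Hy Hs)).
  rewrite ln_mult, ln_exp in L by (try apply exp_pos; easy). lra.
Qed.

(** Going up to [y + 1] from [y + s] is bounded by [ln_Gamma_add_le], while going up
    from [y] is known exactly by the functional equation; the difference bounds the step from [y]
    to [y + s] from below. *)
Lemma ln_Gamma_add_ge y s : 0 < y -> 0 <= s <= 1 ->
  s * ln y - s / y <= ln_Gamma (y + s) - ln_Gamma y.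
Proof.
  intros Hy Hs.
  assert (L := ln_Gamma_add_le (y + s) (1 - s) ltac:(lra) ltac:(lra)).
  replace (y + s + (1 - s)) with (y + 1) in L by ring.
  rewrite ln_Gamma_incr_1 in L by easy.
  assert (D := ln_le_sub1 ((y + s) / y) ltac:(apply Rdiv_lt_0_compat; lra)).
  rewrite ln_div in D by lra.
  replace ((y + s) / y - 1) with (s / y) in D by (field; lra).
  assert (0 <= s / y) by (apply Rle_mult_inv_pos; lra).
  nra.
Qed.

Lemma ln_Gamma_shift y n : 0 < y ->
  ln_Gamma (y + INR (S n)) = ln_Gamma y + sum_n (fun k => ln (y + INR k)) n.
Proof.
  intros Hy; induction n.
  - rewrite sum_O; simpl INR; rewrite Rplus_0_r; now apply ln_Gamma_incr_1.
  - rewrite sum_Sn, S_INR, <- Rplus_assoc, ln_Gamma_incr_1, IHn.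
    + change plus with Rplus; ring.
    + generalize (pos_INR (S n)); lra.
Qed.

(** Far from the origin, [ln_Gamma (y + n) - ln_Gamma (x + n)] is [(y - x) * ln n] up to
    [O(1 / n)] by Wendel's inequality, and the functional equation brings this back to [x] and
    [y]. *)
Lemma is_lim_seq_ln_Gamma_sub_le x y : 0 < x -> x <= y -> y - x <= 1 ->
  is_lim_seq (fun n => (y - x) * ln (INR n + 1)
    - sum_n (fun k => ln (y + INR k) - ln (x + INR k)) n) (ln_Gamma y - ln_Gamma x).
Proof.
  intros Hx Hxy Hy1.
  (* [e] is the error of the approximation far from the origin. *)
  set (e := fun n => ln_Gamma (y + INR (S n)) - ln_Gamma (x + INR (S n))
    - (y - x) * ln (INR n + 1)).
  apply is_lim_seq_ext with (fun n => ln_Gamma y - ln_Gamma x - e n).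
  { intros n; unfold e; rewrite !ln_Gamma_shift by lra.
    replace (sum_n (fun k => ln (y + INR k) - ln (x + INR k)) n) with
      (sum_n (fun k => ln (y + INR k)) n - sum_n (fun k => ln (x + INR k)) n); [ring|].
    induction n; [now rewrite !sum_O|].
    rewrite !sum_Sn, <- IHn; change plus with Rplus; ring. }
  replace (Finite (ln_Gamma y - ln_Gamma x)) with (Finite (ln_Gamma y - ln_Gamma x - 0))
    by (f_equal; ring).
  apply is_lim_seq_minus'; [apply is_lim_seq_const|].
  apply is_lim_seq_le_le with (fun n => -1 * / (INR n + 1)) (fun n => x * / (INR n + 1)).
  - intros n; unfold e; rewrite !S_INR; assert (N := pos_INR n); set (N1 := INR n + 1) in *.
    replace (y + N1) with (x + N1 + (y - x)) by ring.
    assert (U := ln_Gamma_add_le (x + N1) (y - x) ltac:(unfold N1; lra) ltac:(lra)).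
    assert (L := ln_Gamma_add_ge (x + N1) (y - x) ltac:(unfold N1; lra) ltac:(lra)).
    assert (HN : 0 < N1) by (unfold N1; lra).
    assert (D := ln_le_sub1 ((x + N1) / N1) ltac:(apply Rdiv_lt_0_compat; lra)).
    rewrite ln_div in D by lra.
    replace ((x + N1) / N1 - 1) with (x * / N1) in D by (field; lra).
    assert (D0 : ln N1 <= ln (x + N1)) by (apply ln_le; lra).
    assert (I : / (x + N1) <= / N1) by (apply Rinv_le_contravar; lra).
    assert (I0 : 0 < / (x + N1)) by (apply Rinv_0_lt_compat; lra).
    unfold Rdiv in L. split; nra.
  - replace (Finite 0) with (Rbar_mult (-1) 0) by (simpl; f_equal; ring).
    apply is_lim_seq_scal_l, is_lim_seq_inv_S.
  - replace (Finite 0) with (Rbar_mult x 0) by (simpl; f_equal; ring).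
    apply is_lim_seq_scal_l, is_lim_seq_inv_S.
Qed.

(** Both signs of [y - x] are needed for a two-sided derivative. *)
Lemma is_lim_seq_ln_Gamma_sub x y : 0 < x -> 0 < y -> Rabs (y - x) <= 1 ->
  is_lim_seq (fun n => (y - x) * ln (INR n + 1)
    - sum_n (fun k => ln (y + INR k) - ln (x + INR k)) n) (ln_Gamma y - ln_Gamma x).
Proof.
  intros Hx Hy Hd; apply Rabs_le_between in Hd.
  destruct (Rle_dec x y) as [H|H]; [now apply is_lim_seq_ln_Gamma_sub_le|].
  assert (L := is_lim_seq_ln_Gamma_sub_le y x Hy ltac:(lra) ltac:(lra)).
  apply is_lim_seq_opp in L; simpl in L.
  replace (- (ln_Gamma x - ln_Gamma y)) with (ln_Gamma y - ln_Gamma x) in L by ring.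
  revert L; apply is_lim_seq_ext; intros n.
  replace (sum_n (fun k => ln (y + INR k) - ln (x + INR k)) n) with
    (- sum_n (fun k => ln (x + INR k) - ln (y + INR k)) n); [ring|].
  induction n; [rewrite !sum_O; ring|].
  rewrite !sum_Sn, <- IHn; change plus with Rplus; ring.
Qed.

Lemma ln_sub_bounds u v : 0 < u -> 0 < v ->
  0 <= (v - u) * / u - (ln v - ln u) <= (v - u) ^ 2 * / (u * v).
Proof.
  intros Hu Hv; rewrite <- ln_div by easy.
  assert (H : 0 < v / u) by now apply Rdiv_lt_0_compat.
  assert (A := ln_le_sub1 _ H); assert (B := ln_ge_1_sub_inv _ H).
  replace ((v - u) * / u) with (v / u - 1) by (field; lra).
  replace ((v - u) ^ 2 * / (u * v)) with (v / u - 1 - (1 - / (v / u))) by (field; lra).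
  lra.
Qed.

Lemma is_series_ln_Gamma_sub x y : 0 < x -> 0 < y -> Rabs (y - x) <= 1 ->
  is_series (fun k => (y - x) * / (x + INR k) - (ln (y + INR k) - ln (x + INR k)))
    (ln_Gamma y - ln_Gamma x - (y - x) * digamma_series x).
Proof.
  intros Hx Hy Hd.
  set (a := fun k => _).
  change (is_lim_seq (sum_n a) (ln_Gamma y - ln_Gamma x - (y - x) * digamma_series x)).
  assert (L := is_lim_seq_minus' _ _ _ _ (is_lim_seq_ln_Gamma_sub x y Hx Hy Hd)
    (is_lim_seq_scal_l _ (y - x) _ (is_lim_seq_digamma_series x Hx))).
  revert L; apply is_lim_seq_ext; intros n; unfold a.
  induction n; [rewrite !sum_O; ring|].
  rewrite !sum_Sn, <- IHn; change plus with Rplus; ring.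
Qed.

(** In [is_series_ln_Gamma_sub] every summand lies between 0 and
    [(y - x) ^ 2 / ((x + k) * (y + k))], so the error is quadratic. *)
Lemma is_derive_ln_Gamma x : 0 < x -> is_derive ln_Gamma x (digamma_series x).
Proof.
  intros Hx.
  apply is_derive_of_quadratic_error with (Rmin (x / 2) 1) (trigamma_series (x / 2)).
  { apply Rmin_pos; lra. }
  intros y Hy.
  assert (H1 := Rlt_le_trans _ _ _ Hy (Rmin_l _ _)).
  assert (H2 := Rlt_le_trans _ _ _ Hy (Rmin_r _ _)).
  apply Rabs_lt_between in H1.
  rewrite <- (is_series_unique _ _ (is_series_ln_Gamma_sub x y Hx ltac:(lra) ltac:(lra))).
  assert (B : forall k, 0 <= (y - x) * / (x + INR k) - (ln (y + INR k) - ln (x + INR k))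
      <= (y - x) ^ 2 * / ((x + INR k) * (y + INR k))).
  { intros k; replace (y - x) with (y + INR k - (x + INR k)) by ring.
    apply ln_sub_bounds; apply shift_pos; lra. }
  rewrite Rabs_pos_eq.
  - apply Rle_trans with (Series (fun k => (y - x) ^ 2 * / ((x + INR k) * (y + INR k)))).
    + apply Series_le; [easy|].
      apply (ex_series_scal (V := R_NormedModule)), ex_series_inv_prod; lra.
    + rewrite Series_scal_l, Rmult_comm; apply Rmult_le_compat_r; [apply pow2_ge_0|].
      apply Series_inv_prod_le; lra.
  - apply Series_ge_0.
    + intros k; generalize (B k); lra.
    + eexists; apply is_series_ln_Gamma_sub; lra.
Qed.

Lemma locally_gt a x : a < x -> locally x (fun y => a < y).
Proof. intros H; now apply (open_gt a x). Qed.

Lemma locally_lt a x : x < a -> locally x (fun y => y < a).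
Proof. intros H; now apply (open_lt a x). Qed.

Lemma is_derive_Gamma_integral x : 0 < x ->
  is_derive Gamma_integral x (Gamma_integral x * digamma_series x).
Proof.
  intros Hx.
  apply (is_derive_ext_loc (fun y => exp (ln_Gamma y))).
  - generalize (locally_gt 0 x Hx); apply filter_imp; intros y Hy.
    unfold ln_Gamma; now rewrite exp_ln by now apply Gamma_integral_pos.
  - evar_last.
    + apply (is_derive_comp exp ln_Gamma); [apply is_derive_exp|].
      now apply is_derive_ln_Gamma.
    + unfold ln_Gamma; rewrite exp_ln by now apply Gamma_integral_pos.
      unfold scal; simpl; unfold mult; simpl; ring.
Qed.

(** * The functions Gamma, psi and h in terms of the series *)

Lemma Gamma_gt_0 x : 0 < x -> Gamma x = Gamma_integral x.
Proof.
  intros Hx; unfold Gamma.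
  replace (Z.to_nat (up (- x))) with 0%nat; [easy|].
  destruct (archimed (- x)) as [A B].
  assert (up (- x) < 1)%Z by (apply lt_IZR; lra). lia.
Qed.

Lemma Gamma_neg x : -1 < x < 0 -> Gamma x = Gamma_integral (x + 1) / x.
Proof.
  intros Hx; unfold Gamma.
  replace (Z.to_nat (up (- x))) with 1%nat; [easy|].
  destruct (archimed (- x)) as [A B].
  assert (0 < up (- x))%Z by (apply lt_IZR; lra).
  assert (up (- x) < 2)%Z by (apply lt_IZR; lra). lia.
Qed.

Lemma psi_gt_0 x : 0 < x -> psi x = digamma_series x.
Proof.
  intros Hx; unfold psi; rewrite Gamma_gt_0 by easy.
  rewrite (Derive_ext_loc _ Gamma_integral).
  - rewrite (is_derive_unique _ _ _ (is_derive_Gamma_integral x Hx)).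
    field; apply Rgt_not_eq, Gamma_integral_pos, Hx.
  - generalize (locally_gt 0 x Hx); apply filter_imp; apply Gamma_gt_0.
Qed.

(** On [(-1, 0)] the value of [Gamma] is [Gamma_integral (x + 1) / x]; on the positive
    half-line the formula agrees with [psi_gt_0] by the functional equation. *)
Lemma psi_gt_neg1 x : -1 < x -> x <> 0 -> psi x = digamma_series (x + 1) - / x.
Proof.
  intros Hx Hx0; destruct (Rlt_dec 0 x) as [Hp|Hn].
  { rewrite psi_gt_0, digamma_series_incr_1 by easy; ring. }
  assert (D : is_derive (fun y => Gamma_integral (y + 1) / y) x
    ((Gamma_integral (x + 1) * digamma_series (x + 1) * x - Gamma_integral (x + 1) * 1) / x ^ 2)).
  { apply (is_derive_div (fun y => Gamma_integral (y + 1)) (fun y => y)); [| |easy].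
    - evar_last.
      + apply (is_derive_comp Gamma_integral (fun y => y + 1)).
        * apply is_derive_Gamma_integral; lra.
        * auto_derive; [easy | reflexivity].
      + unfold scal; simpl; unfold mult; simpl; ring.
    - auto_derive; easy. }
  apply (is_derive_ext_loc _ Gamma) in D.
  - apply is_derive_unique in D.
    unfold psi; rewrite Gamma_neg by lra; rewrite D.
    assert (P := Gamma_integral_pos (x + 1) ltac:(lra)); field; lra.
  - generalize (filter_and _ _ (locally_gt (-1) x Hx) (locally_lt 0 x ltac:(lra))).
    apply filter_imp; intros y Hy; now rewrite Gamma_neg.
Qed.

Lemma Derive_psi x : -1 < x -> x <> 0 -> Derive psi x = trigamma_series (x + 1) + / x ^ 2.
Proof.
  intros Hx Hx0.
  rewrite (Derive_ext_loc _ (fun y => digamma_series (y + 1) - / y)).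
  - apply is_derive_unique.
    evar_last.
    + apply (is_derive_minus (fun y => digamma_series (y + 1)) (fun y => / y)).
      * apply (is_derive_comp digamma_series (fun y => y + 1)).
        -- apply is_derive_digamma_series; lra.
        -- auto_derive; [easy | reflexivity].
      * auto_derive; [easy | reflexivity].
    + unfold minus, plus, opp, scal; simpl; unfold mult; simpl; field; easy.
  - assert (L : locally x (fun y => y <> 0)) by now apply (open_neq 0 x).
    generalize (filter_and _ _ (locally_gt (-1) x Hx) L).
    apply filter_imp; intros y [H1 H2]; now apply psi_gt_neg1.
Qed.

(** The singular parts [/ x ^ 2] of [psi' x] and [psi (x ^ 2)] cancel, which leaves a
    formula that is regular at 0; there the prescribed value agrees with it thanks to [basel]. *)
Lemma h_eq x : -1 < x ->
  h x = 1 + (x ^ 2 - 1) * trigamma_series (x + 1) - digamma_series (x ^ 2 + 1).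
Proof.
  intros Hx; unfold h; destruct (Req_dec_T x 0) as [->|Hx0].
  - replace (0 + 1) with 1 by ring; replace (0 ^ 2 + 1) with 1 by ring.
    rewrite trigamma_series_1, digamma_series_1; ring.
  - assert (H2 : 0 < x ^ 2) by (generalize (pow2_gt_0 x Hx0); easy).
    rewrite Derive_psi, psi_gt_0, digamma_series_incr_1 by easy.
    field; easy.
Qed.

(** * Monotonicity *)

(** The summand of index [K = k + 1] in the expansion of [h]. *)
Definition h_term (k : nat) (x : R) : R :=
  (x ^ 2 - 1) * / (x + 1 + INR k) ^ 2 - / (INR k + 1) + / (x ^ 2 + 1 + INR k).

Lemma h_term_split k x : h_term k x =
  (x ^ 2 - 1) * / (x + 1 + INR k) ^ 2 - (/ (INR k + 1) - / (x ^ 2 + 1 + INR k)).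
Proof. unfold h_term; ring. Qed.

Lemma ex_h_series x : -1 < x -> ex_series (fun k => h_term k x).
Proof.
  intros Hx.
  apply ex_series_ext with (fun k => (x ^ 2 - 1) * / (x + 1 + INR k) ^ 2
    - (/ (INR k + 1) - / (x ^ 2 + 1 + INR k))).
  { intros k; now rewrite h_term_split. }
  apply (ex_series_minus (V := R_NormedModule) (fun k => (x ^ 2 - 1) * / (x + 1 + INR k) ^ 2)).
  - apply (ex_series_scal (V := R_NormedModule)), ex_trigamma_series; lra.
  - apply ex_digamma_series; generalize (pow2_ge_0 x); lra.
Qed.

Lemma h_eq_series x : -1 < x -> h x = 1 + Euler_gamma + Series (fun k => h_term k x).
Proof.
  intros Hx; rewrite h_eq by easy.
  unfold trigamma_series, digamma_series; rewrite <- Series_scal_l.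
  rewrite (Series_ext _ _ (fun k => h_term_split k x)),
    (Series_minus (fun k => (x ^ 2 - 1) * / (x + 1 + INR k) ^ 2)).
  - ring.
  - apply (ex_series_scal (V := R_NormedModule)), ex_trigamma_series; lra.
  - apply ex_digamma_series; generalize (pow2_ge_0 x); lra.
Qed.

Definition h_term_deriv (k : nat) (x : R) : R :=
  2 * ((INR k + 1) * x + 1) / (x + 1 + INR k) ^ 3 - 2 * x / (x ^ 2 + 1 + INR k) ^ 2.

Lemma is_derive_h_term k x : -1 < x -> is_derive (h_term k) x (h_term_deriv k x).
Proof.
  intros Hx; assert (K := pos_INR k); assert (X := pow2_ge_0 x).
  unfold h_term, h_term_deriv; auto_derive.
  - assert (A : 0 < x + 1 + INR k) by lra.
    repeat split; apply Rgt_not_eq; simpl in X; nra.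
  - field; repeat split; simpl in *; try lra.
Qed.

(** The numerator vanishes to second order at 1 for every [k].  Hence [h] has a
    critical point at 1 without changing direction. *)
Lemma h_term_deriv_factor k x : -1 < x ->
  h_term_deriv k x = 2 * (INR k + 1) * (x - 1) ^ 2
    * (x ^ 3 + 2 * x ^ 2 + 2 * (INR k + 1) * x + (INR k + 1))
    / ((x + 1 + INR k) ^ 3 * (x ^ 2 + 1 + INR k) ^ 2).
Proof.
  intros Hx; assert (K := pos_INR k); assert (X := pow2_ge_0 x).
  unfold h_term_deriv; field; split; simpl in *; lra.
Qed.

Lemma h_term_deriv_ge_0 k x : - / 2 <= x -> 0 <= h_term_deriv k x.
Proof.
  intros Hx; assert (K := pos_INR k); assert (X := pow2_ge_0 x).
  rewrite h_term_deriv_factor by lra.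
  apply Rle_mult_inv_pos.
  - apply Rmult_le_pos.
    + apply Rmult_le_pos; [lra | apply pow2_ge_0].
    + replace (x ^ 3 + 2 * x ^ 2 + 2 * (INR k + 1) * x + (INR k + 1))
        with (x ^ 2 * (x + 2) + (INR k + 1) * (2 * x + 1)) by ring.
      apply Rplus_le_le_0_compat; apply Rmult_le_pos; lra.
  - apply Rmult_lt_0_compat; apply pow_lt; lra.
Qed.

Lemma h_term_deriv_0_gt_0 x : -1 < x -> x <> 1 -> 0 < h_term_deriv 0 x.
Proof.
  intros Hx Hx1; rewrite h_term_deriv_factor by easy.
  assert (X := pow2_ge_0 x); simpl (INR 0).
  apply Rdiv_lt_0_compat.
  - apply Rmult_lt_0_compat.
    + apply Rmult_lt_0_compat; [lra|]. apply pow2_gt_0; lra.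
    + nra.
  - apply Rmult_lt_0_compat; apply pow_lt; lra.
Qed.

(** To the left of [-1/2] the later summands may decrease; the first one compensates
    because of its pole at [-1]. *)
Lemma h_term_deriv_0_ge x : -1 < x <= - / 2 -> 8 <= h_term_deriv 0 x.
Proof.
  intros Hx; assert (X := pow2_ge_0 x).
  unfold h_term_deriv; simpl (INR 0).
  replace (2 * ((0 + 1) * x + 1) / (x + 1 + 0) ^ 3) with (2 * / (x + 1) ^ 2) by (field; lra).
  assert (A : / (/ 4) <= / (x + 1) ^ 2).
  { apply Rinv_le_contravar; [apply pow_lt; lra | nra]. }
  assert (B : 0 <= - 2 * x / (x ^ 2 + 1 + 0) ^ 2).
  { apply Rle_mult_inv_pos; [lra|]. apply pow_lt; lra. }
  replace (2 * x / (x ^ 2 + 1 + 0) ^ 2) with (- (- 2 * x / (x ^ 2 + 1 + 0) ^ 2)) by (field; lra).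
  lra.
Qed.

(** These losses add up to at most [2 * PI ^ 2 / 6], which is below the gain 8 of
    [h_term_deriv_0_ge]. *)
Lemma h_term_deriv_S_ge k x : -1 < x <= - / 2 -> - (2 * / (INR k + 1) ^ 2) <= h_term_deriv (S k) x.
Proof.
  intros Hx; assert (K := pos_INR k); assert (X := pow2_ge_0 x).
  unfold h_term_deriv; rewrite S_INR; set (K1 := INR k + 1) in *.
  assert (HK : 1 <= K1) by (unfold K1; lra).
  assert (B : 0 <= - 2 * x / (x ^ 2 + 1 + K1) ^ 2).
  { apply Rle_mult_inv_pos; [lra|]. apply pow_lt; lra. }
  replace (2 * x / (x ^ 2 + 1 + K1) ^ 2) with (- (- 2 * x / (x ^ 2 + 1 + K1) ^ 2)) by (field; lra).
  enough (- (2 * / K1 ^ 2) <= 2 * ((K1 + 1) * x + 1) / (x + 1 + K1) ^ 3) by lra.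
  replace (- (2 * / K1 ^ 2)) with (- 2 * K1 * / K1 ^ 3) by (field; lra).
  unfold Rdiv.
  apply Rle_trans with (- 2 * K1 * / (x + 1 + K1) ^ 3).
  - apply Rmult_le_compat_neg_l; [lra|].
    apply Rinv_le_contravar; [apply pow_lt; lra | apply pow_incr; lra].
  - apply Rmult_le_compat_r; [apply Rlt_le, Rinv_0_lt_compat, pow_lt; lra | nra].
Qed.

Lemma h_term_MVT k x y : -1 < x -> x < y ->
  exists c, x < c < y /\ h_term k y - h_term k x = h_term_deriv k c * (y - x).
Proof.
  intros Hx Hxy.
  destruct (MVT_cor2 (h_term k) (h_term_deriv k) x y Hxy) as [c [E Hc]].
  - intros c Hc; apply is_derive_Reals, is_derive_h_term; lra.
  - now exists c.
Qed.

(** The first summand is isolated because it carries the strict increase. *)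
Lemma h_sub_series x y : -1 < x -> x < y ->
  h y - h x = (h_term 0 y - h_term 0 x) + Series (fun k => h_term (S k) y - h_term (S k) x)
  /\ ex_series (fun k => h_term (S k) y - h_term (S k) x).
Proof.
  intros Hx Hxy; rewrite !h_eq_series by lra.
  assert (Ey := ex_h_series y ltac:(lra)); assert (Ex := ex_h_series x Hx).
  assert (E : ex_series (fun k => h_term k y - h_term k x)).
  { now apply (ex_series_minus (V := R_NormedModule) (fun k => h_term k y)). }
  split.
  - rewrite <- (Series_incr_1 (fun k => h_term k y - h_term k x)) by easy.
    rewrite Series_minus by easy; ring.
  - now apply -> (ex_series_incr_1 (V := R_NormedModule) (fun k => h_term k y - h_term k x)).
Qed.

(** The side condition keeps the critical point 1 out of the open interval. *)
Lemma h_increasing_right x y : - / 2 <= x -> x < y -> (y <= 1 \/ 1 <= x) -> h x < h y.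
Proof.
  intros Hx Hxy H1.
  destruct (h_sub_series x y) as [E Hex]; [lra..|].
  enough (0 < h y - h x) by lra; rewrite E; apply Rplus_lt_le_0_compat.
  - destruct (h_term_MVT 0 x y) as [c [Hc ->]]; [lra..|].
    apply Rmult_lt_0_compat; [apply h_term_deriv_0_gt_0|]; lra.
  - apply Series_ge_0; [|easy]; intros k.
    destruct (h_term_MVT (S k) x y) as [c [Hc ->]]; [lra..|].
    apply Rmult_le_pos; [apply h_term_deriv_ge_0|]; lra.
Qed.

Lemma h_increasing_left x y : -1 < x -> x < y -> y <= - / 2 -> h x < h y.
Proof.
  intros Hx Hxy Hy.
  destruct (h_sub_series x y) as [E Hex]; [lra..|].
  assert (A : 8 * (y - x) <= h_term 0 y - h_term 0 x).
  { destruct (h_term_MVT 0 x y) as [c [Hc ->]]; [lra..|].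
    apply Rmult_le_compat_r; [lra|]. apply h_term_deriv_0_ge; lra. }
  assert (B : - (2 * (y - x)) * (PI ^ 2 / 6) <= Series (fun k => h_term (S k) y - h_term (S k) x)).
  { rewrite <- (is_series_unique _ _ basel), <- Series_scal_l.
    apply Rminus_le_0; rewrite <- Series_minus; [|easy|].
    - apply Series_ge_0.
      + intros k.
        destruct (h_term_MVT (S k) x y) as [c [Hc ->]]; [lra..|].
        assert (D := h_term_deriv_S_ge k c ltac:(lra)). nra.
      + apply (ex_series_minus (V := R_NormedModule) _
          (fun k => - (2 * (y - x)) * / (INR k + 1) ^ 2)); [easy|].
        apply (ex_series_scal (V := R_NormedModule)); eexists; apply basel.
    - apply (ex_series_scal (V := R_NormedModule)); eexists; apply basel. }
  assert (P := PI_RGT_0); assert (P4 := PI_4).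
  assert (PI ^ 2 <= 16) by nra. nra.
Qed.

Lemma h_increasing x y : -1 < x -> x < y -> h x < h y.
Proof.
  intros Hx Hxy.
  assert (R1 : forall x y, - / 2 <= x -> x < y -> h x < h y).
  { clear; intros x y Hx Hxy.
    destruct (Rle_dec y 1) as [H|H]; [apply h_increasing_right; lra|].
    destruct (Rle_dec 1 x) as [H'|H']; [apply h_increasing_right; lra|].
    apply Rlt_trans with (h 1); apply h_increasing_right; lra. }
  destruct (Rle_dec (- / 2) x) as [H|H]; [now apply R1|].
  destruct (Rle_dec y (- / 2)) as [H'|H']; [now apply h_increasing_left|].
  apply Rlt_trans with (h (- / 2)); [apply h_increasing_left | apply R1]; lra.
Qed.

(** * Behaviour at the ends of the domain *)

(** Only the first summand of the trigamma series matters: it contributes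
    [(x ^ 2 - 1) / (x + 1) ^ 2 = 1 - 2 / (x + 1)], and the digamma term is at least its value
    at 1. *)
Lemma h_le_near_neg1 x : -1 < x < 0 -> h x <= 2 + Euler_gamma - / (x + 1).
Proof.
  intros Hx; rewrite h_eq by lra; assert (X := pow2_ge_0 x).
  assert (D := digamma_series_le 1 (x ^ 2 + 1) Rlt_0_1 ltac:(lra)).
  rewrite digamma_series_1 in D.
  assert (T := trigamma_series_ge_inv_sq (x + 1) ltac:(lra)).
  assert (I : (1 - x ^ 2) * / (x + 1) ^ 2 <= (1 - x ^ 2) * trigamma_series (x + 1)).
  { apply Rmult_le_compat_l; [nra | easy]. }
  replace ((1 - x ^ 2) * / (x + 1) ^ 2) with (2 * / (x + 1) - 1) in I by (field; lra).
  assert (0 < / (x + 1)) by (apply Rinv_0_lt_compat; lra). lra.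
Qed.

(** The trigamma term is at least [x - 1] and the digamma term is at most
    [ln (x ^ 2 + 1) <= 2 * ln (1 + x)]; the tangent line of the logarithm at 4 shows that the
    latter grows at most like [x / 2]. *)
Lemma h_ge_at_infty x : 1 <= x -> x / 2 - 2 * ln 4 <= h x.
Proof.
  intros Hx; rewrite h_eq by lra.
  assert (D := digamma_series_le_ln (x ^ 2 + 1) ltac:(nra)).
  assert (T := trigamma_series_ge_inv (x + 1) ltac:(lra)).
  assert (I : (x ^ 2 - 1) * / (x + 1) <= (x ^ 2 - 1) * trigamma_series (x + 1)).
  { apply Rmult_le_compat_l; [nra | easy]. }
  replace ((x ^ 2 - 1) * / (x + 1)) with (x - 1) in I by (field; lra).
  assert (L : ln (x ^ 2 + 1) <= 2 * ln (1 + x)).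
  { replace (2 * ln (1 + x)) with (ln (1 + x) + ln (1 + x)) by ring.
    rewrite <- ln_mult by lra; apply ln_le; nra. }
  assert (L' := ln_le_sub1 ((1 + x) / 4) ltac:(lra)).
  rewrite ln_div in L' by lra. lra.
Qed.

Theorem theorem5 :
  (forall x y : R, -1 < x -> x < y -> h x < h y) /\
  filterlim h (at_right (-1)) (Rbar_locally m_infty) /\
  filterlim h (Rbar_locally p_infty) (Rbar_locally p_infty).
Proof.
  repeat split.
  - exact h_increasing.
  - intros P [M HP].
    (* [1 <= K] keeps the neighbourhood of radius [/ K] to the left of 0. *)
    set (K := Rmax 1 (2 + Euler_gamma - M)).
    assert (HK : 1 <= K) by apply Rmax_l.
    assert (HK' : 2 + Euler_gamma - M <= K) by apply Rmax_r.
    assert (Hd : 0 < / K) by (apply Rinv_0_lt_compat; lra).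
    exists (mkposreal _ Hd); intros x Hx Hx1; apply HP.
    change (Rabs (x - -1) < / K) in Hx; apply Rabs_lt_between in Hx.
    assert (I : / K <= 1) by (rewrite <- Rinv_1; apply Rinv_le_contravar; lra).
    assert (J : K < / (x + 1)).
    { rewrite <- (Rinv_inv K); apply Rinv_lt_contravar; [|lra].
      apply Rmult_lt_0_compat; lra. }
    assert (B := h_le_near_neg1 x ltac:(lra)). lra.
  - intros P [M HP].
    exists (Rmax 1 (2 * M + 4 * ln 4)); intros x Hx; apply HP.
    assert (A1 := Rmax_l 1 (2 * M + 4 * ln 4)).
    assert (A2 := Rmax_r 1 (2 * M + 4 * ln 4)).
    assert (B := h_ge_at_infty x ltac:(lra)). lra.
Qed.
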